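(* Let $S$ be (the face semigroup of) an oriented matroid of rank $3$. Then the following are equivalent: $\sigma_1\sigma_2=\sigma_2\sigma_1$; $\sigma_1\sigma_3=\sigma_3\sigma_1$; $\sigma_2\sigma_3=\sigma_3\sigma_2$; $S$ is simplicial.
   Context: The covectors of an oriented matroid form a left regular band under composition $(FG)_e=F_e$ if $F_e\neq 0$ and $G_e$ otherwise, with identity the zero covector. For rank $3$, the nonzero covectors correspond to the cells of a regular cell decomposition of the $2$-sphere (for a central plane arrangement in $\mathbb{R}^3$, the faces intersected with the unit sphere): rank-$1$ faces are vertices, rank-$2$ faces are edges, rank-$3$ faces are chambers (topes). $\sigma_i$ is the sum of all faces of rank $i$ in the semigroup algebra over $\mathbb{Q}$. $S$ is simplicial if every chamber is a triangle. *)

(* Defs.v *)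
From HB Require Import structures.
From mathcomp Require Import all_boot all_order all_algebra.
From mathcomp Require Import monalg.

Set Implicit Arguments.
Unset Strict Implicit.
Unset Printing Implicit Defensive.

(* Signs are encoded in [option bool]:
   [None] is 0, [Some true] is +, [Some false] is -. *)
Definition sign : Type := option bool.
HB.instance Definition _ := Finite.on sign.

Definition sign_opp (s : sign) : sign := omap negb s.

Notation signvec E := {ffun E -> sign}.

Section SignVectors.
Variable E : finType.

Implicit Types F G : signvec E.

Definition sv0 : signvec E := [ffun=> None].

Definition sv_opp F : signvec E := [ffun e => sign_opp (F e)].

Definition sv_comp F G : signvec E :=
  [ffun e => if F e == None then G e else F e].

Definition sv_sep F G : {set E} :=
  [set e | (F e != None) && (G e == sign_opp (F e))].

(* The conformal order: [F] is a face of [G]. *)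
Definition sv_le F G : bool := [forall e, (F e == None) || (F e == G e)].

End SignVectors.

(* Oriented matroids on the ground set [E], presented by covectors. Loops and
   parallel elements are allowed. *)
Record orientedMatroid (E : finType) := OrientedMatroid {
  covectors :> {set signvec E};
  covector0 : sv0 E \in covectors;
  covectorN : forall F, F \in covectors -> sv_opp F \in covectors;
  covectorM : forall F G, F \in covectors -> G \in covectors ->
    sv_comp F G \in covectors;
  covector_elim : forall F G e, F \in covectors -> G \in covectors ->
    e \in sv_sep F G ->
    exists2 H : signvec E, H \in covectors &
      H e = None /\ forall f, f \notin sv_sep F G -> H f = sv_comp F G f
}.

Section FaceSemigroup.
Variables (E : finType) (M : orientedMatroid E).

Record face := Face {face_val :> signvec E; faceP : face_val \in M}.
HB.instance Definition _ := [isSub for face_val].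
HB.instance Definition _ := [Finite of face by <:].

Implicit Types F G H : face.

Definition face0 : face := Face (covector0 M).

Definition face_comp F G : face := Face (covectorM (faceP F) (faceP G)).

Lemma face_compA : associative face_comp.
Proof.
move=> F G H; apply/val_inj/ffunP => e; rewrite !ffunE.
by case: (F e).
Qed.

Lemma face_comp0l : left_id face0 face_comp.
Proof. by move=> F; apply/val_inj/ffunP => e; rewrite !ffunE eqxx. Qed.

Lemma face_comp0r : right_id face0 face_comp.
Proof.
by move=> F; apply/val_inj/ffunP => e; rewrite !ffunE; case: (F e).
Qed.

Lemma face_comp_eq0 F G : face_comp F G = face0 -> F = face0 /\ G = face0.
Proof.
move=> FG0; have F0 : F = face0.
  apply/val_inj/ffunP => e; have /(congr1 val)/ffunP/(_ e) := FG0.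
  by rewrite !ffunE; case: (F e).
by split=> //; rewrite -FG0 F0 face_comp0l.
Qed.

(* This makes [{malg rat[face]}] the semigroup algebra over [rat]. *)
HB.instance Definition _ := Choice_isMonomialDef.Build face
  face_compA face_comp0l face_comp0r face_comp_eq0.

Definition face_le F G : bool := sv_le F G.

Definition face_chain (C : {set face}) : bool :=
  [forall F in C, forall G in C, face_le F G || face_le G F].

(* The length of a longest chain [0 < F_1 < ... < F_k = F]; the set [C] below
   is [{F_1, ..., F_k}]. *)
Definition face_rank F : nat :=
  \max_(C : {set face} |
      face_chain C && (C \subset [set G | (G != face0) && face_le G F])) #|C|.

Definition om_rank : nat := \max_(F : face) face_rank F.

Definition sigma (i : nat) : {malg rat[face]} :=
  (\sum_(F : face | face_rank F == i) << F >>)%R.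

Definition faces_of_rank (i : nat) (C : face) : {set face} :=
  [set F | (face_rank F == i) && face_le F C].

(* For [M] of rank 3: a polygonal cell [C] of the sphere is a triangle when it
   has three vertices and three edges. *)
Definition triangle (C : face) : bool :=
  (#|faces_of_rank 1 C| == 3) && (#|faces_of_rank 2 C| == 3).

Definition simplicial3 : Prop :=
  forall C : face, face_rank C = 3 -> triangle C.

End FaceSemigroup.

(* Main.v *)
(* Let u be the sum of (-1)^(rank F) F over all faces F.  For all faces F and H,
   the signed count of the G with G F = H is (-1)^(rank H) if -F <= H and 0
   otherwise, so u F is the signed sum of the faces above -F; summing these
   counts shows that (-F) u is the same element.  Hence u commutes with every
   sigma_i.  In rank 3, u = 1 - sigma_1 + sigma_2 - sigma_3, and so the three
   commutators of the sigma_i agree up to sign.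

   An edge lies in exactly two topes, namely F C and F (-C) for any tope C,
   whence sigma_2 sigma_3 = sigma_3 sigma_2 if and only if n f_3 = 2 f_2 for the
   number n of sides of each tope, where f_i is the number of faces of rank i.
   Since 3 f_3 = 2 f_2 for triangles, simplicial implies commuting.  Conversely
   all topes have the same number n of sides.  Vertices have degree at least 4,
   so that 2 f_1 <= f_2, and Euler's formula f_1 - f_2 + f_3 = 2 gives n < 4;
   and n >= 3 because f_1 > 2. *)
Require Import Defs.
From mathcomp Require Import all_boot all_order all_algebra.
From mathcomp Require Import monalg zify.

Set Implicit Arguments.
Unset Strict Implicit.
Unset Printing Implicit Defensive.

Section Faces.
Variables (E : finType) (M : orientedMatroid E).
Implicit Types (C D F G H K T W X Y v : face M) (e f : E).

Local Notation "F ** G" := (face_comp F G) (at level 40, left associativity).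
Local Notation "F <=f G" := (face_le F G) (at level 70, no associativity).
Local Notation "0f" := (face0 M) (at level 0).

(** * Opposites, the conformal order and supports *)

Definition face_opp F : face M := Face (covectorN (faceP F)).
Local Notation "-f F" := (face_opp F) (at level 35, right associativity).

Definition supp F : {set E} := [set e | F e != None].

Lemma face_compE F G e : (F ** G) e = if F e == None then G e else F e.
Proof. by rewrite /= ffunE. Qed.

Lemma face_oppE F e : (-f F) e = sign_opp (F e).
Proof. by rewrite /= ffunE. Qed.

Lemma face0E e : 0f e = None.
Proof. by rewrite /= ffunE. Qed.

Lemma face_eqP F G : (forall e, F e = G e) -> F = G.
Proof. by move=> FG; apply/val_inj/ffunP. Qed.

Lemma face_leP F G : reflect (forall e, F e = None \/ F e = G e) (F <=f G).
Proof.
apply: (iffP forallP) => FG e; first by case/orP: (FG e) => /eqP; [left|right].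
by case: (FG e) => ->; rewrite eqxx ?orbT.
Qed.

Lemma face_oppK : involutive face_opp.
Proof.
by move=> F; apply: face_eqP => e; rewrite !face_oppE; case: (F e) => [[]|].
Qed.

Lemma face_le_refl F : F <=f F.
Proof. by apply/face_leP => e; right. Qed.

Lemma face_le_trans G F H : F <=f G -> G <=f H -> F <=f H.
Proof.
move=> /face_leP FG /face_leP GH; apply/face_leP => e.
by case: (FG e) => [|->]; [left | exact: GH].
Qed.

Lemma face_le_anti F G : F <=f G -> G <=f F -> F = G.
Proof.
move=> /face_leP FG /face_leP GF; apply: face_eqP => e.
by case: (FG e) (GF e) => [->|->] [->|].
Qed.

Lemma face_le_compr F G : F <=f F ** G.
Proof.
by apply/face_leP => e; rewrite face_compE; case: eqP => [->|]; [left|right].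
Qed.

Lemma face_leE F G : (F <=f G) = (F ** G == G).
Proof.
apply/idP/eqP => [/face_leP FG|<-]; last exact: face_le_compr.
by apply: face_eqP => e; rewrite face_compE; case: (FG e) => ->; case: eqP.
Qed.

Lemma face_le0 F : 0f <=f F.
Proof. by apply/face_leP => e; left; rewrite face0E. Qed.

Lemma suppP F G :
  reflect (forall e, G e = None -> F e = None) (supp F \subset supp G).
Proof.
apply: (iffP subsetP) => FG e; last first.
  by rewrite !inE; apply: contra_neq; exact: FG.
by have := FG e; rewrite !inE; case: (F e) => // a /(_ isT) + Ge; rewrite Ge.
Qed.

Lemma supp_le F G : F <=f G -> supp F \subset supp G.
Proof. by move=> /face_leP FG; apply/suppP => e Ge; case: (FG e) => ->. Qed.

Lemma supp_comp F G : supp (F ** G) = supp F :|: supp G.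
Proof. by apply/setP => e; rewrite !inE face_compE; case: (F e). Qed.

Lemma supp_opp F : supp (-f F) = supp F.
Proof. by apply/setP => e; rewrite !inE face_oppE; case: (F e). Qed.

Lemma face_le_supp F G : F <=f G -> supp G \subset supp F -> F = G.
Proof.
move=> /face_leP FG /suppP GF; apply: face_eqP => e.
by case: (FG e) => // Fe; rewrite Fe (GF e).
Qed.

Lemma supp_lt F G : F <=f G -> F != G -> supp F \proper supp G.
Proof.
move=> FG neqFG; rewrite properE supp_le //=.
by apply: contra neqFG => /(face_le_supp FG) ->.
Qed.

Lemma comp_supp F G : supp G \subset supp F -> F ** G = F.
Proof.
move=> /suppP GF; apply: face_eqP => e; rewrite face_compE.
by case: eqP => // Fe; rewrite GF.
Qed.

(** * Separation sets and covector elimination *)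

Lemma sv_sep0_eq F G :
  supp F = supp G -> sv_sep F G = set0 -> F = G.
Proof.
move=> /setP FG /setP sep0; apply: face_eqP => e.
have := FG e; have := sep0 e; rewrite !inE.
by case: (F e) => [[]|]; case: (G e) => [[]|].
Qed.

Lemma face_elim F G e : e \in sv_sep F G -> exists X : face M,
  X e = None /\ forall f, f \notin sv_sep F G -> X f = (F ** G) f.
Proof.
move=> /(covector_elim (faceP F) (faceP G))[X MX XP].
by exists (Face MX).
Qed.

(** Elimination at a separated [e] gives an [X] that vanishes at [e] and agrees with [H] off
    [sv_sep H Y]. If [X] is not below [H], then [X ** H] takes the place of [Y]: its separation set
    from [H] is smaller, since it no longer contains [e]. *)
Lemma ex_sep_face H Y :
    supp Y \subset supp H -> sv_sep H Y != set0 -> exists X,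
  [/\ X <=f H, X != H & forall f, f \notin sv_sep H Y -> X f = H f].
Proof.
have [n] := ubnP #|sv_sep H Y|; elim: n => // n IHn in Y *.
rewrite ltnS => le_n YH /set0Pn[e e_sep].
have [X [Xe XP]] := face_elim e_sep.
have XH f : f \notin sv_sep H Y -> X f = H f by move=> /XP->; rewrite comp_supp.
have He : H e != None by move: e_sep; rewrite inE => /andP[].
have XneH : X != H by apply: contraNneq He => <-; rewrite Xe.
have [XleH|XnleH] := boolP (X <=f H); first by exists X.
have sXH : supp X \subset supp H.
  apply/suppP => f Hf; rewrite XH // inE Hf eqxx //.
have sub_sep : sv_sep H (X ** H) \subset sv_sep H Y :\ e.
  apply/subsetP => f; rewrite in_setD1 => f_sep.
  apply/andP; split.
    apply: contraTneq f_sep => ->; rewrite inE face_compE Xe eqxx.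
    by case: (H e) => [[]|].
  apply: contraTT f_sep => /XH Xf; rewrite inE face_compE Xf.
  by case: (H f) => [[]|].
have lt_n : #|sv_sep H (X ** H)| < n.
  apply: leq_ltn_trans (subset_leq_card sub_sep) _.
  by rewrite (cardsD1 e) e_sep in le_n.
have [||X' [X'H neqX'H X'P]] := IHn (X ** H) lt_n.
- by rewrite supp_comp subUset sXH /=.
- apply: contraNneq XnleH => sep0.
  rewrite (@sv_sep0_eq H (X ** H)) ?face_le_compr // supp_comp.
  by apply/esym/setUidPr.
exists X'; split=> // f f_sep; apply: X'P; apply: contra f_sep.
by move/(subsetP sub_sep); rewrite inE => /andP[].
Qed.

(** * Covering pairs of faces and reflection in a facet *)

Definition face_covers H K := [/\ K <=f H, K != H &
  forall X, K <=f X -> X <=f H -> X = K \/ X = H].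

Lemma ex_face_covers X H : X <=f H -> X != H ->
  exists2 K, X <=f K & face_covers H K.
Proof.
move=> XH neqXH; pose P K := [&& X <=f K, K <=f H & K != H].
have PX : P X by rewrite /P face_le_refl XH.
case: (@arg_maxnP _ X P (fun K => #|supp K|) PX) => K /and3P[XK KH neqKH] Kmax.
exists K => //; split=> // Y KY YH.
have [->|neqYH] := eqVneq Y H; [by right|left].
have /Kmax le_YK : P Y by rewrite /P (face_le_trans XK) ?YH.
apply/eqP; apply: contraTT le_YK; rewrite eq_sym -ltnNge => neqKY.
by apply: proper_card; exact: supp_lt.
Qed.

(** Suppose [Y] differs from [H]. The proper face of [H] given by [ex_sep_face] lies above [K],
    because separated elements are outside [supp K]. So it equals [K], and [Y] is opposite to [H]
    wherever [K] vanishes. *)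
Lemma face_covers_flip H K Y : face_covers H K -> K <=f Y ->
  supp Y = supp H -> Y = H \/ Y = K ** -f H.
Proof.
move=> [KH neqKH Kmax] KY eqs.
have [sep0|sepN0] := eqVneq (sv_sep H Y) set0.
  by left; rewrite (sv_sep0_eq (esym eqs) sep0).
right; have [|X [XH neqXH XP]] := ex_sep_face _ sepN0; first by rewrite eqs.
have eqXK : X = K.
  case: (Kmax X) => // [|eqXH]; last by rewrite eqXH eqxx in neqXH.
  apply/face_leP => e; have := XP e; rewrite inE.
  move/face_leP/(_ e): KH; move/face_leP/(_ e): KY.
  case: (K e) => [k|]; last by left.
  by move=> [//|<-] [//|<-] ->; [right | case: k].
apply: face_eqP => e; rewrite face_compE face_oppE; case: eqP => [Ke|Ke].
  have := XP e; rewrite inE eqXK Ke; case He: (H e) => [h|] /=.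
    by case: eqP => // _ /(_ isT).
  by move=> _; have /setP/(_ e) := eqs; rewrite !inE He /=; case: (Y e).
by move/face_leP/(_ e): KY => [|->].
Qed.

(* The elements of [supp H :\: supp K] are parallel once restricted to the
   flat spanned by [H]. *)
Lemma face_covers_sign H K G : face_covers H K -> supp G \subset supp H ->
  [\/ forall e, K e = None -> G e = None,
      forall e, K e = None -> G e = H e |
      forall e, K e = None -> G e = sign_opp (H e)].
Proof.
move=> KH GH; have [KleH neqKH _] := KH.
have suppKG X : supp X = supp H -> supp (K ** G ** X) = supp H.
  move=> sX; rewrite !supp_comp sX; apply/setUidPr.
  by rewrite subUset supp_le.
have KleKG X : K <=f K ** G ** X by rewrite -face_compA face_le_compr.
have [e Ke He] : exists2 e, K e = None & H e <> None.
  move: (supp_lt KleH neqKH) => /properP[_ [e]]; rewrite !inE => He Ke.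
  by exists e; [case: (K e) Ke | apply/eqP].
(* Each of [K ** G ** H] and [K ** G ** -f H] is [H] or its reflection in [K]. Where [K] vanishes
   they read off [G], completed by [H] or by [-f H], so the outcomes tell the three cases apart. *)
have flip := face_covers_flip KH (KleKG _) (suppKG _ _).
have flipH := flip _ erefl; have flipN := flip _ (supp_opp H).
have at_ X Y f : K ** G ** X = Y -> K f = None ->
    (if G f == None then X f else G f) = Y f.
  by move=> <- Kf; rewrite !face_compE Kf eqxx.
have Gf0 f : K f = None -> H f = None -> G f = None.
  by move=> _ Hf; move/suppP: GH; apply.
case: flipH => [/at_ eqH|/at_ eqH]; last first.
  constructor 3 => f Kf; have := eqH f Kf; have := Gf0 f Kf.
  rewrite face_compE Kf eqxx face_oppE.
  by case: (H f) => [[]|]; case: (G f) => [[]|] //= /(_ erefl).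
case: flipN => [/at_ eqN|/at_ eqN].
  constructor 2 => f Kf; have := eqN f Kf; have := Gf0 f Kf.
  rewrite face_oppE.
  by case: (H f) => [[]|]; case: (G f) => [[]|] //= /(_ erefl).
constructor 1 => f Kf; have := eqN f Kf; have := eqH f Kf; have := Gf0 f Kf.
rewrite face_compE Kf eqxx face_oppE.
by case: (H f) => [[]|]; case: (G f) => [[]|] //= /(_ erefl).
Qed.

(** * Rank as the length of a longest chain *)

Lemma face_rank0 : face_rank 0f = 0.
Proof.
apply/eqP; rewrite -leqn0; apply/bigmax_leqP => C /andP[_ /subsetP C0].
rewrite leqn0 cards_eq0; apply/eqP/setP => F; rewrite inE.
apply/negP => /C0; rewrite inE => /andP[/eqP F0 Fle0]; case: F0.
exact: face_le_anti Fle0 (face_le0 F).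
Qed.

Lemma face_chainP (C : {set face M}) :
  reflect {in C &, forall F G, (F <=f G) || (G <=f F)} (face_chain C).
Proof.
apply: (iffP forall_inP) => [H F G FC GC|H F FC].
  by have /forall_inP/(_ G GC) := H F FC.
by apply/forall_inP => G GC; exact: H.
Qed.

Lemma face_rank_witness F : exists2 C : {set face M}, face_rank F = #|C| &
  face_chain C && (C \subset [set G | (G != 0f) && (G <=f F)]).
Proof.
rewrite /face_rank; set P := BIG_P.
have P0 : 0 < #|P|.
  apply/card_gt0P; exists set0; apply/andP; split; last exact: sub0set.
  by apply/face_chainP => ?; rewrite inE.
by have [C PC ->] := eq_bigmax_cond (fun C : {set face M} => #|C|) P0; exists C.
Qed.

Lemma leq_face_rank F (C : {set face M}) :
    face_chain C -> (forall G, G \in C -> (G != 0f) && (G <=f F)) ->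
  #|C| <= face_rank F.
Proof.
move=> chC CF.
apply: (@leq_bigmax_cond _ _ (fun C : {set face M} => #|C|)).
by rewrite chC; apply/subsetP => G /CF; rewrite inE.
Qed.

Lemma face_rank_lt F G : F <=f G -> F != G -> face_rank F < face_rank G.
Proof.
move=> FG neqFG.
have [C -> /andP[/face_chainP chC /subsetP CF]] := face_rank_witness F.
have CFP H : H \in C -> (H != 0f) && (H <=f F) by move/CF; rewrite inE.
have GnC : G \notin C.
  apply/negP => /CFP/andP[_ GF]; move/eqP: neqFG; apply; exact: face_le_anti.
have -> : #|C|.+1 = #|G |: C| by rewrite cardsU1 GnC.
have le_G H : H \in G |: C -> H <=f G.
  case/setU1P => [->|/CFP/andP[_ HF]]; first exact: face_le_refl.
  exact: face_le_trans FG.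
apply: leq_face_rank => [|H HC].
  apply/face_chainP => H1 H2 H1C H2C.
  case/setU1P: (H1C) => [->|{}H1C']; first by rewrite (le_G H2) ?orbT.
  case/setU1P: (H2C) => [->|{}H2C']; first by rewrite le_G.
  exact: chC.
rewrite le_G // andbT; case/setU1P: HC => [->|/CFP/andP[]//].
apply: contraNneq neqFG => G0; rewrite G0 in FG *.
by rewrite (face_le_anti FG (face_le0 F)).
Qed.

Lemma face_rank_le F G : F <=f G -> face_rank F <= face_rank G.
Proof.
by have [->//|neq FG] := eqVneq F G; exact/ltnW/face_rank_lt.
Qed.

(** [G] is the largest element other than [F] of a longest chain below [F], or the zero face if
    there is none. The chain without [F] then lies below [G]. *)
Lemma face_rank_pred F : F != 0f ->
  exists G, [/\ G <=f F, G != F & face_rank F = (face_rank G).+1].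
Proof.
move=> F0.
have [C rkF /andP[/face_chainP chC /subsetP CF]] := face_rank_witness F.
have CFP H : H \in C -> (H != 0f) && (H <=f F) by move/CF; rewrite inE.
suff [G [GF neqGF leG]] : exists G,
    [/\ G <=f F, G != F & #|C :\ F| <= face_rank G].
  exists G; split=> //; apply/eqP; rewrite eqn_leq face_rank_lt // andbT rkF.
  by rewrite (cardsD1 F C); case: (F \in C); rewrite // add0n ltnW.
have [->|[G GC]] := set_0Vmem (C :\ F).
  by exists 0f; rewrite face_le0 eq_sym F0 cards0.
case: (@arg_maxnP _ G (fun G => G \in C :\ F) (fun K => #|supp K|) GC).
move=> {GC}G /setD1P[neqGF GC] Gmax; exists G; split=> //.
  by case/andP: (CFP G GC).
apply: leq_face_rank => [|H HC].
  by apply/face_chainP => H1 H2 /setD1P[_ +] /setD1P[_ +]; exact: chC.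
case/setD1P: (HC) => neqHF HC'; case/andP: (CFP H HC') => -> HF /=.
case/orP: (chC _ _ HC' GC) => // GH; have /= := Gmax _ HC.
have [->|neqGH] := eqVneq G H; first by rewrite face_le_refl.
by rewrite leqNgt proper_card // supp_lt.
Qed.

(** * Walks through adjacent cells; monotonicity of the rank in the support *)

Lemma face_covers_witness H K : face_covers H K ->
  exists2 e, K e = None & H e <> None.
Proof.
move=> [KH neqKH _]; have /properP[_ [e]] := supp_lt KH neqKH.
by rewrite !inE => /eqP He /negPn/eqP Ke; exists e.
Qed.

(** The face [X] of [F] from [ex_sep_face] vanishes within [supp F] only at elements separating [F]
    from [T], and so does a facet [K] above it. Reflecting in [K] therefore removes separated
    elements and adds none. *)
Lemma face_gallery_step F T : supp F = supp T -> F != T -> exists K : face M,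
  [/\ face_covers F K, forall e, K e = None -> T e = sign_opp (F e) &
      #|sv_sep (K ** -f F) T| < #|sv_sep F T|].
Proof.
move=> eqs neqFT; have [||X [XF neqXF XP]] := @ex_sep_face F T.
- by rewrite eqs.
- by apply: contra neqFT => /eqP /(sv_sep0_eq eqs) ->.
have [K XK covK] := ex_face_covers XF neqXF; have [KF _ _] := covK.
have KT e : K e = None -> T e = sign_opp (F e).
  move=> Ke; have := XP e; move/face_leP/(_ e): XK; rewrite Ke => -[] ->;
  by rewrite inE; have /setP/(_ e) := eqs; rewrite !inE;
    case: (F e) => [[]|]; case: (T e) => [[]|] //= _ /(_ isT).
exists K; split=> //; apply: proper_card; rewrite properE; apply/andP; split.
  apply/subsetP => e; rewrite !inE face_compE face_oppE.
  case: (K e =P None) => [/KT->|]; first by case: (F e) => [[]|].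
  by move/face_leP/(_ e): KF => [//|->].
have [e Ke Fe] := face_covers_witness covK.
apply/subsetPn; exists e; rewrite inE (KT e Ke).
  by rewrite eqxx andbT; apply/eqP.
by rewrite face_compE Ke eqxx face_oppE; case: (F e) Fe => [[]|].
Qed.

(** [H] and [-f G] are separated exactly on [supp G], so elimination between them leaves [H]
    unchanged off that set. *)
Lemma ex_elim_le G H e : G <=f H -> G e <> None -> exists Q : face M,
  [/\ Q e = None, supp Q \subset supp H & forall f, G f = None -> Q f = H f].
Proof.
move=> /face_leP GH Ge.
have [|Q [Qe QP]] := @face_elim H (-f G) e.
  rewrite inE face_oppE; case: (GH e) => // <-.
  by rewrite eqxx andbT; apply/eqP.
exists Q; split=> //.
  apply/suppP => f Hf; rewrite QP; last by rewrite inE Hf.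
  by rewrite face_compE Hf face_oppE; case: (GH f) => ->; rewrite ?Hf.
move=> f Gf; rewrite QP; last first.
  by rewrite inE face_oppE Gf; case: (H f) => [[]|].
by rewrite face_compE face_oppE Gf; case: eqP => // ->.
Qed.

Lemma supp_flip F K : K <=f F -> supp (K ** -f F) = supp F.
Proof. by move=> KF; rewrite supp_comp supp_opp; apply/setUidPr/supp_le. Qed.

(* Both bounds are proved together by induction on the support.  For the first,
   a face [G] of [H] off the hyperplane of [K] is replaced by a largest covector
   [X] of that hyperplane below the support of [G]; a covector [Q] of the
   hyperplane obtained by elimination then strictly enlarges [X]. *)
Lemma face_covers_rank_supp n :
  (forall H K, #|supp H| < n -> face_covers H K ->
     face_rank H <= (face_rank K).+1) /\
  (forall H W, #|supp H| < n -> supp W \subset supp H ->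
     face_rank W <= face_rank H).
Proof.
elim: n => [//|n [rank_cov rank_supp]].
have cov_n H K : #|supp H| < n.+1 -> face_covers H K ->
    face_rank H <= (face_rank K).+1.
  rewrite ltnS => le_n covK; have [KH neqKH _] := covK.
  have H0 : H != 0f.
    apply: contraNneq neqKH => H0; rewrite H0 in KH *.
    exact/eqP/face_le_anti/face_le0.
  have [G [GH neqGH ->]] := face_rank_pred H0; rewrite ltnS.
  have lt_supp X : X <=f H -> X != H -> #|supp X| < n.
    by move=> XH /(supp_lt XH)/proper_card/leq_trans; apply.
  have [e Ke He] := face_covers_witness covK.
  have flatK X : supp X \subset supp H -> X e = None -> supp X \subset supp K.
    move=> XH Xe; apply/suppP; case: (face_covers_sign covK XH) => // /(_ e Ke);
    by rewrite Xe; case: (H e) He.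
  have sGH := supp_le GH.
  have [Ge|Ge] := eqVneq (G e) None.
    by apply: rank_supp; [exact: lt_supp | exact: flatK].
  pose P X := (supp X \subset supp G) && (X e == None).
  have P0 : P 0f.
    rewrite /P face0E eqxx andbT; apply/suppP => f _; exact: face0E.
  case: (@arg_maxnP _ 0f P (fun X => #|supp X|) P0).
  move=> X /andP[sXG /eqP Xe] Xmax.
  have sXGE : supp (X ** G) = supp G by rewrite supp_comp; apply/setUidPr.
  have leXY : X <=f X ** G by exact: face_le_compr.
  have covY : face_covers (X ** G) X.
    split=> // [|X' XX' X'Y].
      apply: contraNneq Ge => /(congr1 (fun F : face M => F e)).
      by rewrite face_compE Xe /= => <-.
    have sX' : supp X' \subset supp G by rewrite -sXGE supp_le.
    have [X'e|X'e] := eqVneq (X' e) None.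
      left; apply/eqP; rewrite eq_sym; apply: contraT => neq.
      have := Xmax X'; rewrite /P sX' X'e /= => /(_ isT).
      by rewrite leqNgt proper_card // supp_lt.
    (* Here [X'] is nonzero at [e]. Were it zero at some [f] where [X ** G] is not, eliminating [e]
       would give a [Q] with [X ** Q] in [P] and nonzero at [f], against the maximality of [X]. *)
    right; apply: face_le_supp => //; apply/suppP => f X'f.
    have [Q [Qe sQ QP]] := ex_elim_le X'Y (elimN eqP X'e).
    have sXQ : P (X ** Q).
      by rewrite /P supp_comp subUset sXG -{1}sXGE sQ face_compE Xe Qe.
    have /= := Xmax _ sXQ; rewrite leqNgt => /negP leXQ.
    apply/eqP; apply: contraT => Yf; case: leXQ; apply: proper_card.
    apply/properP; rewrite supp_comp; split; first exact: subsetUl.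
    exists f; rewrite !inE; first by rewrite QP ?Yf ?orbT.
    by case/face_leP/(_ f): XX' => ->; rewrite ?X'f.
  have [Q [Qe sQ QP]] := ex_elim_le GH (elimN eqP Ge).
  have le_GX : face_rank G <= (face_rank X).+1.
    apply: leq_trans (rank_cov _ _ _ covY); last by rewrite sXGE lt_supp.
    by apply: rank_supp; rewrite sXGE // lt_supp.
  apply: leq_trans le_GX _; apply: (@leq_trans (face_rank (X ** Q))).
    apply: face_rank_lt; first exact: face_le_compr.
    have /properP[_ [f]] := supp_lt GH neqGH; rewrite !inE negbK => Hf /eqP Gf.
    have Xf : X f = None by move/suppP: sXG; apply.
    apply/eqP => /(congr1 (fun F : face M => F f)).
    rewrite face_compE Xf eqxx QP //.
    by case: (H f) Hf.
  apply: rank_supp; first exact: lt_supp.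
  by rewrite supp_comp subUset !flatK // (subset_trans sXG).
split=> // H W ltn WH.
(* The walk from [W ** H], which has the support of [H], to [H] never lowers the rank: [F] has rank
   at most one more than its facet [K], and the reflected cell lies strictly above [K]. *)
apply: (@leq_trans (face_rank (W ** H))).
  exact/face_rank_le/face_le_compr.
have : supp (W ** H) = supp H by rewrite supp_comp; apply/setUidPr.
move: (W ** H) => {WH}F; have [m] := ubnP #|sv_sep F H|.
elim: m => // m IHm in F *; rewrite ltnS => le_m eqs.
have [->//|neqFH] := eqVneq F H.
have [K [covK KP lt_sep]] := face_gallery_step eqs neqFH.
have [KF neqKF _] := covK; have sF' := supp_flip KF.
apply: (@leq_trans (face_rank (K ** -f F))).
  apply: leq_trans (cov_n _ _ _ covK) _; first by rewrite eqs.
  apply: face_rank_lt; first exact: face_le_compr.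
  apply: contraNneq neqKF => eqK.
  by rewrite (face_le_supp KF) // -sF' -eqK.
by apply: IHm; [exact: leq_trans le_m | rewrite sF'].
Qed.

Lemma face_rank_supp H W : supp W \subset supp H -> face_rank W <= face_rank H.
Proof. by case: (face_covers_rank_supp #|supp H|.+1) => _; apply. Qed.

Lemma face_covers_rank H K : face_covers H K -> face_rank H = (face_rank K).+1.
Proof.
move=> covK; have [KH neqKH _] := covK; apply/eqP; rewrite eqn_leq.
rewrite face_rank_lt // andbT.
by case: (face_covers_rank_supp #|supp H|.+1) => + _; apply.
Qed.

Lemma face_rank_opp F : face_rank (-f F) = face_rank F.
Proof. by apply/eqP; rewrite eqn_leq !face_rank_supp ?supp_opp. Qed.

(** * Signed counts of faces *)

Import GRing.Theory Num.Theory.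
Local Open Scope ring_scope.

(** This lets [F] be assumed to have the support of [H]. Where both [G] and [F] vanish, [-f H] can
    agree with [H] only if [H] vanishes too. *)
Lemma euler_fiber_wlog F H : supp F \subset supp H ->
  (forall G, (G ** F == H) = (G ** (F ** -f H) == H)) /\
  (-f F <=f H) = (-f (F ** -f H) <=f H).
Proof.
move=> /suppP sFH; split=> [G|].
  rewrite face_compA; apply/eqP/eqP => [->|GF].
    by apply: comp_supp; rewrite supp_opp.
  apply: face_eqP => e; move/(congr1 (fun F : face M => F e)): GF.
  rewrite [LHS]face_compE; case: eqP => // ->.
  by rewrite face_oppE; case: (H e) => [[]|].
apply/face_leP/face_leP => FH e; have := FH e; rewrite !face_oppE face_compE.
  by case: eqP => // -> _; right; rewrite face_oppE; case: (H e) => [[]|].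
by case: eqP => // ->; left.
Qed.

(* [F] is walked through adjacent cells towards [- H].  Crossing the facet [K]
   of [F] changes the sum by the same kind of sum for [K] and a facet of [H],
   which vanishes until [- H] is reached. *)
Lemma euler_fiber (R : pzRingType) F H :
  \sum_(G | G ** F == H) (-1) ^+ face_rank G =
    if -f F <=f H then (-1) ^+ face_rank H else 0 :> R.
Proof.
have [n] := ubnP #|supp H|; elim: n => // n IHn in F H *; rewrite ltnS => le_n.
have [sFH|sFH] := boolP (supp F \subset supp H); last first.
  rewrite ifN; last by apply: contra sFH => /supp_le; rewrite supp_opp.
  apply: big_pred0 => G; apply: contraNF sFH => /eqP <-.
  by rewrite supp_comp subsetUr.
have [fibE leE] := euler_fiber_wlog sFH.
rewrite (eq_bigl _ _ fibE) leE {fibE leE}.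
have : supp (F ** -f H) = supp H.
  by rewrite supp_comp supp_opp; apply/setUidPr.
move: (F ** -f H) => {sFH}F.
have [m] := ubnP #|sv_sep F (-f H)|; elim: m => // m IHm in F *.
rewrite ltnS => le_m eqs.
have [->|neqF] := eqVneq F (-f H).
  rewrite face_oppK face_le_refl (big_pred1 H) // => G.
  apply/eqP/eqP => [GH|->]; last by apply: comp_supp; rewrite supp_opp.
  apply: face_eqP => e; move/(congr1 (fun F : face M => F e)): GH.
  by rewrite face_compE face_oppE; case: eqP => // ->; case: (H e) => [[]|].
have [|K [covK KP lt_sep]] := face_gallery_step _ neqF.
  by rewrite supp_opp.
have [KF neqKF _] := covK; have sF' := supp_flip KF.
have [e0 Ke0 Fe0] := face_covers_witness covK.
have HZ e : K e = None -> H e = F e.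
  by move/KP; rewrite face_oppE; case: (H e) => [[]|]; case: (F e) => [[]|].
have F0 e : (F e == None) = (H e == None).
  by have /setP/(_ e) := eqs; rewrite !inE => /negb_inj.
have KE e : K e <> None -> K e = F e by case/face_leP/(_ e): KF.
set F' := K ** -f F in lt_sep sF' *.
have F'E e : F' e = if K e == None then sign_opp (F e) else F e.
  by rewrite face_compE face_oppE; case: eqP => // /KE.
(* Every solution [G] for [F'] is one for [F], because [H] agrees with [F] where [K] vanishes. The
   solutions for [F] alone form [P] below. *)
clearbody F'; rewrite (bigID (fun G => G ** F' == H)) /=.
rewrite [X in X + _](_ : _ = \sum_(G | G ** F' == H) (-1) ^+ face_rank G);
  last first.
  apply: eq_bigl => G; apply: andb_idl => /eqP GF'; apply/eqP/face_eqP => e.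
  move/(congr1 (fun F : face M => F e)): GF'; rewrite !face_compE F'E.
  case: (G e) => [//|] /=; case: eqP => // /HZ <-.
  by case: (H e) => [[]|].
rewrite IHm ?sF' //; last exact: leq_trans le_m.
rewrite [in RHS]ifN; last first.
  apply: contra neqF => /face_le_supp FH; rewrite -[F]face_oppK FH //.
  by rewrite supp_opp eqs.
have F'H : (-f F' <=f H) = [forall e, (K e == None) || (sign_opp (F e) == H e)].
  apply/face_leP/forallP => le e; have := le e; rewrite face_oppE F'E.
    case: eqP => //= Ke [|->//].
    by have := F0 e; case: (F e) => [[]|] //= /esym/eqP ->.
  case: eqP => [/HZ -> _|_ /eqP]; last by right.
  by right; case: (F e) => [[]|].
pose P G := (G ** F == H) && (G ** F' != H).
(* Otherwise, by [face_covers_sign], [G] agrees with [F] or with [-f F] where [K] vanishes. The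
   first makes [G] a solution for [F']; the second contradicts [HZ]. *)
have PZ G : P G -> forall e, K e = None -> G e = None.
  move=> /andP[/eqP GF GF'].
  have sG : supp G \subset supp F by rewrite eqs -GF supp_comp subsetUl.
  case: (face_covers_sign covK sG) => // GZ; last first.
    move/(congr1 (fun F : face M => F e0)): GF.
    rewrite face_compE (GZ e0 Ke0) (HZ e0 Ke0).
    by case: (F e0) Fe0 => [[]|].
  case/eqP: GF'; apply: face_eqP => e.
  move/(congr1 (fun F : face M => F e)): GF; rewrite !face_compE F'E.
  by case: eqP => // Ge; case: eqP => // Ke; rewrite -(GZ e Ke) Ge => <-.
(* If [P] is empty, the sum for [F'] must vanish by itself: were [-f F' <=f H], the face [-f K]
   would satisfy [P]. *)
have [G0 PG0|noP] := pickP P; last first.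
  rewrite big_pred0 // addr0 ifN //; apply/negP; rewrite F'H => /forallP le.
  move/negbT/negP: (noP (-f K)); case; apply/andP; split.
    apply/eqP/face_eqP => e; rewrite face_compE face_oppE.
    have := le e; case: (K e =P None) => [Ke _|Ke /eqP <-].
      by rewrite Ke HZ.
    by rewrite -KE //; case: (K e) Ke => [[]|].
  apply/eqP => /(congr1 (fun F : face M => F e0)).
  rewrite face_compE face_oppE F'E Ke0 HZ //=.
  by case: (F e0) Fe0 => [[]|].
(* [Ha] is [H] with the entries where [K] vanishes set to zero. It is covered by [H], and [P]
   consists of the solutions of [G ** K = Ha], so the two sums cancel by the drop of one in rank. *)
pose Ha := G0 ** K.
have HaE e : Ha e = if K e == None then None else H e.
  rewrite face_compE; case: eqP => [Ge|Ge].
    have /andP[/eqP/(congr1 (fun F : face M => F e)) + _] := PG0.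
    by rewrite face_compE Ge /=; case: eqP => // Ke <-; rewrite KE.
  case: eqP => [Ke|Ke]; first by case: Ge; apply: (PZ G0).
  have /andP[/eqP/(congr1 (fun F : face M => F e)) + _] := PG0.
  by rewrite face_compE; case: eqP Ge.
have HaH : Ha <=f H.
  by apply/face_leP => e; rewrite HaE; case: eqP; [left|right].
have neqHa : Ha != H.
  apply/eqP => /(congr1 (fun F : face M => F e0)); rewrite HaE Ke0 HZ //=.
  by case: (F e0) Fe0 => [[]|].
have covHa : face_covers H Ha.
  split=> // X HaX XH; have sX : supp X \subset supp F by rewrite eqs supp_le.
  case: (face_covers_sign covK sX) => XZ.
  - left; apply: face_eqP => e; rewrite HaE; case: eqP => [/XZ//|Ke].
    move/face_leP/(_ e): HaX; rewrite HaE; case: eqP => // _ [He|->//].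
    by move/face_leP/(_ e): XH => -[->|].
  - right; apply: face_eqP => e; have [/eqP Ke|Ke] := boolP (K e == None).
      by rewrite XZ ?HZ.
    move/face_leP/(_ e): HaX; rewrite HaE (negPf Ke) => -[He|->//].
    by move/face_leP/(_ e): XH => -[->|].
  - move/face_leP/(_ e0): XH; rewrite XZ ?HZ //.
    by case: (F e0) Fe0 => [[]|] // _ [].
rewrite [X in _ + X](_ : _ = \sum_(G | G ** K == Ha) (-1) ^+ face_rank G);
  last first.
  apply: eq_bigl => G; apply/idP/eqP => [PG|GK].
    apply: face_eqP => e; rewrite face_compE HaE.
    have /andP[/eqP/(congr1 (fun F : face M => F e)) + _] := PG.
    rewrite face_compE; case: (eqVneq (K e) None) => [Ke|/eqP Ke].
      by rewrite (PZ G PG e Ke) /= Ke.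
    by rewrite KE.
  have GKe e : (if G e == None then K e else G e) =
      if K e == None then None else H e.
    by rewrite -HaE -GK face_compE.
  have GZ e : K e = None -> G e = None.
    by move=> Ke; have := GKe e; rewrite Ke /=; case: eqP => // ->.
  apply/andP; split.
    apply/eqP/face_eqP => e; rewrite face_compE; have := GKe e.
    have [/eqP Ke _|/eqP Ke] := boolP (K e == None); last by rewrite KE.
    by rewrite GZ //= HZ.
  apply/eqP => /(congr1 (fun F : face M => F e0)).
  rewrite face_compE GZ //= F'E Ke0 /= HZ //.
  by case: (F e0) Fe0 => [[]|].
rewrite IHn; last exact: leq_trans (proper_card (supp_lt HaH neqHa)) le_n.
have -> : (-f K <=f Ha) = (-f F' <=f H).
  rewrite F'H; apply/face_leP/forallP => le e; have := le e.
    rewrite face_oppE HaE; case: (K e =P None) => //= Ke.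
    by rewrite -KE //; case: (K e) Ke => [[]|] // _ [] // ->.
  rewrite face_oppE HaE; case: (K e =P None) => [->|Ke /= /eqP <-].
    by left.
  by right; rewrite KE.
rewrite (face_covers_rank covHa) exprS mulN1r; case: ifP => _.
  exact: addNr.
exact: addr0.
Qed.

(** [F ** G] depends only on [H' = G ** -f F], so the [G] are grouped by [H']. By [euler_fiber] a
    group contributes only if [F <=f H'], and then [H'] is [F ** H' = H]. *)
Lemma euler_cofiber (R : pzRingType) F H :
  \sum_(G | F ** G == H) (-1) ^+ face_rank G =
    if F <=f H then (-1) ^+ face_rank H else 0 :> R.
Proof.
have [FH|FH] := boolP (F <=f H); last first.
  rewrite big_pred0 // => G; apply: contraNF FH => /eqP <-.
  exact: face_le_compr.
have absorb G : F ** (G ** -f F) = F ** G.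
  by rewrite face_compA comp_supp // supp_opp supp_comp subsetUl.
rewrite (partition_big (fun G => G ** -f F) (fun H' => F ** H' == H)) /=;
  last by move=> G; rewrite absorb.
have inner H' : F ** H' == H ->
    \sum_(G | (F ** G == H) && (G ** -f F == H')) (-1) ^+ face_rank G =
      if H' == H then (-1) ^+ face_rank H else 0 :> R.
  move=> FH'; rewrite (eq_bigl (fun G => G ** -f F == H')) => [|G]; last first.
    by apply: andb_idl => /eqP GF; rewrite -absorb GF.
  rewrite euler_fiber face_oppK face_leE (eqP FH') eq_sym.
  by case: eqP => // ->.
rewrite (eq_bigr _ inner) -big_mkcondr (big_pred1 H) // => H'.
by apply: andb_idl => /eqP ->; rewrite -face_leE.
Qed.

(** [G <=f H] means [G ** H = H], and [-f H <=f H] holds only for the zero face. *)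
Lemma euler_le (R : pzRingType) H : H != 0f ->
  \sum_(G | G <=f H) (-1) ^+ face_rank G = 0 :> R.
Proof.
move=> H0; under eq_bigl do rewrite face_leE.
rewrite euler_fiber ifN //; apply: contra H0 => /face_leP le.
apply/eqP/face_eqP => e; have := le e; rewrite face_oppE face0E.
by case: (H e) => [[]|] // [].
Qed.

(** The interval is a fiber of right multiplication by [-f F ** H]: since [-f F] has the wrong sign
    on [supp F], [G] must supply the signs of [F] itself. *)
Lemma euler_interval (R : pzRingType) F H : F <=f H -> F != H ->
  \sum_(G | (F <=f G) && (G <=f H)) (-1) ^+ face_rank G = 0 :> R.
Proof.
move=> FH neqFH; move/face_leP: (FH) => leFH.
rewrite (eq_bigl (fun G => G ** (-f F ** H) == H)) => [|G].
  rewrite euler_fiber ifN //; apply: contra neqFH => /face_leP le.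
  apply/eqP/face_eqP => e; have := le e.
  rewrite face_oppE face_compE face_oppE.
  by case: (leFH e) => ->; case: (H e) => [[]|] //= -[?|?].
apply/andP/eqP => [[/face_leP FG /face_leP GH]|GFH].
  apply: face_eqP => e; rewrite !face_compE face_oppE.
  move: (FG e) (GH e) (leFH e).
  by case: (F e) => [[]|]; case: (G e) => [[]|]; case: (H e) => [[]|] //=;
    move=> [?|?] [?|?] [?|?].
have at_e e : (if G e == None then
    if sign_opp (F e) == None then H e else sign_opp (F e) else G e) = H e.
  by rewrite -{2}GFH !face_compE face_oppE.
by split; apply/face_leP => e; move: (at_e e) (leFH e);
  case: (F e) => [[]|]; case: (G e) => [[]|]; case: (H e) => [[]|] //=;
  move=> ? [?|?] //; auto.
Qed.

Lemma sum_face_rank (P : pred (face M)) n :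
  (forall G, P G -> face_rank G < n)%N ->
  \sum_(G | P G) (-1) ^+ face_rank G =
    \sum_(i < n) (-1) ^+ i * #|[set G | P G & face_rank G == i]|%:Z :> int.
Proof.
move=> ltn; transitivity (\sum_(i < n) \sum_(G | P G && (face_rank G == i))
    (-1) ^+ face_rank G : int); last first.
  apply: eq_bigr => i _.
  rewrite (eq_bigr (fun=> (-1) ^+ i)) => [|G /andP[_ /eqP->] //].
  rewrite sumr_const -[Posz _]natz mulr_natr; congr (_ *+ _).
  by apply: eq_card => G; rewrite !inE.
rewrite (exchange_big_dep P) => [|i G _ /andP[] //]; apply: eq_bigr => G PG.
rewrite (big_pred1 (Ordinal (ltn G PG))) // => i.
by rewrite PG /= -val_eqE /= eq_sym.
Qed.

(** * The alternating sum of all faces in the semigroup algebra *)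

Local Notation malgM := {malg rat[face M]}.

Lemma mcoeff_sumU (P : pred (face M)) (c : face M -> rat) K :
  (\sum_(F | P F) << c F *g F >> : malgM)@_K = if P K then c K else 0.
Proof.
rewrite raddf_sum /=; under eq_bigr do rewrite mcoeffU.
have [PK|PK] := boolP (P K); last first.
  by rewrite big1 // => F PF; case: eqP => // FK; rewrite -FK PF in PK.
rewrite (bigD1 K) //= eqxx big1 ?addr0 // => F /andP[_ /negPf -> //].
Qed.

Definition euler_elt : malgM := \sum_F << (-1) ^+ face_rank F *g F >>.

Lemma malgUM (a b : rat) F G :
  << a *g F >> * << b *g G >> = << a * b *g F ** G >> :> malgM.
Proof. exact: fgmulUU. Qed.

Lemma euler_eltMU F : euler_elt * << F >> =
  \sum_(H | -f F <=f H) << (-1) ^+ face_rank H *g H >>.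
Proof.
rewrite mulr_suml (partition_big (fun G => G ** F) xpredT) //=.
rewrite [RHS]big_mkcond /=; apply: eq_bigr => H _.
transitivity (<< \sum_(G | G ** F == H) (-1) ^+ face_rank G *g H >> : malgM).
  by rewrite raddf_sum; apply: eq_bigr => G /eqP <-; rewrite malgUM mulr1.
by rewrite euler_fiber; case: ifP => // _; rewrite raddf0.
Qed.

Lemma euler_eltUM F : << F >> * euler_elt =
  \sum_(H | F <=f H) << (-1) ^+ face_rank H *g H >>.
Proof.
rewrite mulr_sumr (partition_big (fun G => F ** G) xpredT) //=.
rewrite [RHS]big_mkcond /=; apply: eq_bigr => H _.
transitivity (<< \sum_(G | F ** G == H) (-1) ^+ face_rank G *g H >> : malgM).
  by rewrite raddf_sum; apply: eq_bigr => G /eqP <-; rewrite malgUM mul1r.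
by rewrite euler_cofiber; case: ifP => // _; rewrite raddf0.
Qed.

(** Moving [euler_elt] past a face turns [F] into [-f F], and this involution permutes the faces of
    each rank. *)
Lemma euler_elt_comm i : euler_elt * sigma M i = sigma M i * euler_elt.
Proof.
rewrite [LHS]mulr_sumr.
transitivity (\sum_(F | face_rank F == i) << -f F >> * euler_elt : malgM).
  by apply: eq_bigr => F _; rewrite euler_eltMU euler_eltUM.
rewrite [RHS]mulr_suml [RHS](reindex_inj (inv_inj face_oppK)) /=.
by apply: eq_bigl => F; rewrite face_rank_opp.
Qed.

Lemma mcoeff_euler_elt K : euler_elt@_K = (-1) ^+ face_rank K.
Proof. exact: mcoeff_sumU. Qed.

Lemma mcoeff_sigma i K : (sigma M i)@_K = (face_rank K == i)%:R.
Proof. by rewrite [LHS]mcoeff_sumU; case: eqP. Qed.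

(** * Extremal ranks, and commutators with an alternating sum *)

Lemma face_rank_om F : (face_rank F <= om_rank M)%N.
Proof. exact: leq_bigmax. Qed.

Lemma om_rank_witness : exists F : face M, face_rank F = om_rank M.
Proof.
have [|F FP] := @eq_bigmax _ (@face_rank E M); last by exists F.
by apply/card_gt0P; exists 0f.
Qed.

(** [F ** G] lies above [F], hence equals [F] when [F] has top rank. *)
Lemma face_rank_om_supp F G : face_rank F = om_rank M -> supp G \subset supp F.
Proof.
move=> rkF; have leFG := face_le_compr F G.
have [->|neq] := eqVneq F (F ** G); first by rewrite supp_comp subsetUr.
by have := face_rank_om (F ** G); rewrite -rkF leqNgt face_rank_lt.
Qed.

Lemma rank_succ_covers K H :
  K <=f H -> face_rank H = (face_rank K).+1 -> face_covers H K.
Proof.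
move=> KH rkH; split=> // [|X KX XH].
  by apply: contra_eqN rkH => /eqP ->; rewrite neq_ltn ltnSn.
have [->|neqX] := eqVneq X K; first by left.
have [->|neqXH] := eqVneq X H; first by right.
have := face_rank_lt XH neqXH; rewrite rkH ltnS leqNgt face_rank_lt //.
by rewrite eq_sym.
Qed.

Lemma face_rank_eq0 F : (face_rank F == 0%N) = (F == 0f).
Proof.
apply/eqP/eqP => [rkF|->]; last exact: face_rank0.
apply/eqP; apply: contraT => F0.
have := face_rank_lt (face_le0 F); rewrite rkF face_rank0.
by rewrite eq_sym F0 => /(_ isT).
Qed.

(** Once [a] and [a * a] cancel, the hypothesis reads [b * a - c * a = a * b - a * c]. *)
Lemma altsum_comm_fst (R : pzRingType) (a b c : R) :
  (1 - a + b - c) * a = a * (1 - a + b - c) ->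
  a * b = b * a <-> a * c = c * a.
Proof.
rewrite !(mulrDl, mulrDr, mulNr, mulrN) mul1r mulr1 -!addrA => /addrI/addrI eqs.
split=> [ab|ac]; first by move: eqs; rewrite ab => /addrI/oppr_inj.
by move: eqs; rewrite ac => /addIr.
Qed.

Lemma altsum_comm_last (R : pzRingType) (a b c : R) :
  (1 - a + b - c) * c = c * (1 - a + b - c) ->
  a * c = c * a <-> b * c = c * b.
Proof.
rewrite !(mulrDl, mulrDr, mulNr, mulrN) mul1r mulr1 => /addIr.
rewrite -!addrA => /addrI eqs.
split=> [ac|bc]; first by move: eqs; rewrite ac => /addrI.
by move: eqs; rewrite bc => /addIr/oppr_inj.
Qed.

(** * Rank three: equivalence of the commutation relations *)

Section RankThree.
Local Open Scope nat_scope.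
Hypothesis rank3 : om_rank M = 3.

Local Notation f_ i := #|[set F : face M | face_rank F == i]|.

Lemma face_rank_le3 F : (face_rank F < 4).
Proof. by rewrite ltnS -rank3 face_rank_om. Qed.

Lemma euler_elt_sigma :
  (euler_elt = 1 - sigma M 1 + sigma M 2 - sigma M 3)%R.
Proof.
apply/malgP => K.
rewrite mcoeff_euler_elt mcoeffB mcoeffD mcoeffB mcoeff1 !mcoeff_sigma.
have -> : (K == mone) = (face_rank K == 0) by rewrite face_rank_eq0.
by have := face_rank_le3 K; case: (face_rank K) => [|[|[|[|]]]].
Qed.

Lemma sigma_comm12_13 :
  (sigma M 1 * sigma M 2 = sigma M 2 * sigma M 1 <->
   sigma M 1 * sigma M 3 = sigma M 3 * sigma M 1)%R.
Proof.
by apply: altsum_comm_fst; rewrite -euler_elt_sigma; apply: euler_elt_comm.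
Qed.

Lemma sigma_comm13_23 :
  (sigma M 1 * sigma M 3 = sigma M 3 * sigma M 1 <->
   sigma M 2 * sigma M 3 = sigma M 3 * sigma M 2)%R.
Proof.
by apply: altsum_comm_last; rewrite -euler_elt_sigma; apply: euler_elt_comm.
Qed.

(** * Euler relations and incidence counts *)

Lemma faces_of_rank0 H : faces_of_rank 0 H = [set 0f].
Proof.
apply/setP => G; rewrite !inE face_rank_eq0; apply: andb_idr => /eqP ->.
exact: face_le0.
Qed.

Lemma faces_of_rank_top H i : face_rank H = i -> faces_of_rank i H = [set H].
Proof.
move=> <-; apply/setP => G; rewrite !inE; apply/andP/eqP => [[/eqP rkG GH]|->].
  by apply/eqP; apply: contraT => /(face_rank_lt GH); rewrite rkG ltnn.
by rewrite face_le_refl.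
Qed.

Lemma sum_faces_of_rank H : H != 0f ->
  (\sum_(i < (face_rank H).+1)
     (-1) ^+ i * #|faces_of_rank i H|%:Z = 0 :> int)%R.
Proof.
move=> H0; have := euler_le int H0.
rewrite (@sum_face_rank _ (face_rank H).+1) => [sum0|G]; last first.
  exact: face_rank_le.
rewrite -[RHS]sum0; apply: eq_bigr => i _; congr (_ * Posz _)%R.
by apply: eq_card => G; rewrite !inE andbC.
Qed.

Lemma face_rank_neq0 H n : face_rank H = n.+1 -> H != 0f.
Proof. by rewrite -face_rank_eq0 => ->. Qed.

(** With [x] vertices, the Euler relation below an edge is [1 - x + 1 = 0]. *)
Lemma card_edge_vertices H : face_rank H = 2 -> #|faces_of_rank 1 H| = 2.
Proof.
move=> rkH; have := sum_faces_of_rank (face_rank_neq0 rkH).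
rewrite rkH !big_ord_recr big_ord0 /= faces_of_rank0.
rewrite (faces_of_rank_top rkH) !cards1; lia.
Qed.

Lemma card_tope_vertices D : face_rank D = 3 ->
  #|faces_of_rank 1 D| = #|faces_of_rank 2 D|.
Proof.
move=> rkD; have := sum_faces_of_rank (face_rank_neq0 rkD).
rewrite rkD !big_ord_recr big_ord0 /= faces_of_rank0.
rewrite (faces_of_rank_top rkD) !cards1; lia.
Qed.

(** For a tope [T] every face solves [T ** G = T], so [euler_cofiber] sums over all faces:
    [1 - f_1 + f_2 - f_3 = -1]. *)
Lemma euler_count : (f_ 1 + f_ 3 = f_ 2 + 2).
Proof.
have [T rkT] := om_rank_witness; rewrite rank3 in rkT.
have := @sum_face_rank xpredT 4 (fun G _ => face_rank_le3 G).
rewrite (eq_bigl (fun G => T ** G == T)) => [|G]; last first.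
  by rewrite comp_supp ?eqxx // face_rank_om_supp ?rank3.
rewrite euler_cofiber face_le_refl rkT !big_ord_recr big_ord0 /=.
have -> : [set G : face M | face_rank G == 0] = [set 0f].
  by apply/setP => G; rewrite !inE face_rank_eq0.
rewrite cards1; lia.
Qed.

Lemma card_corner_edges v D : face_rank v = 1 -> face_rank D = 3 ->
  v <=f D -> #|[set G | (v <=f G) && (G <=f D) & face_rank G == 2]| = 2.
Proof.
move=> rkv rkD vD; have neqvD : v != D.
  by apply: contra_eq_neq rkv => ->; rewrite rkD.
have := euler_interval int vD neqvD.
rewrite (@sum_face_rank _ 4) => [|G _]; last exact: face_rank_le3.
rewrite !big_ord_recr big_ord0 /=.
have -> : [set G | (v <=f G) && (G <=f D) & face_rank G == 0] = set0.
  apply/setP => G; rewrite !inE; apply/negP.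
  move=> /andP[/andP[/face_rank_le le _] /eqP rkG].
  by rewrite rkv rkG in le.
have -> : [set G | (v <=f G) && (G <=f D) & face_rank G == 1] = [set v].
  apply/setP => G; rewrite !inE; apply/andP/eqP => [[/andP[vG _] /eqP rkG]|->].
    apply/eqP; apply: contraT; rewrite eq_sym => /(face_rank_lt vG).
    by rewrite rkG rkv.
  by rewrite face_le_refl vD rkv.
have -> : [set G | (v <=f G) && (G <=f D) & face_rank G == 3] = [set D].
  apply/setP => G; rewrite !inE; apply/andP/eqP => [[/andP[_ GD] /eqP rkG]|->].
    by apply/eqP; apply: contraT => /(face_rank_lt GD); rewrite rkG rkD.
  by rewrite face_le_refl vD rkD.
rewrite !cards1 cards0; lia.
Qed.

(** At an element where [v] vanishes and [F] does not, the reflection of [F] has the sign opposite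
    to [D], which no face of [D] has. *)
Lemma flip_neq v F G D : v <=f F -> v != F -> F <=f D -> G <=f D ->
  v ** -f F != G.
Proof.
move=> vF neqvF /face_leP FD /face_leP GD.
have /properP[_ [e]] := supp_lt vF neqvF; rewrite !inE negbK => Fe /eqP ve.
apply/eqP => /(congr1 (fun F : face M => F e)).
rewrite face_compE ve face_oppE /=; move: Fe (FD e) (GD e).
by case: (F e) => [[]|] // _ [//|<-] [->|->].
Qed.

Lemma flipK v F : v <=f F -> v ** -f (v ** -f F) = F.
Proof.
move=> /face_leP vF; apply: face_eqP => e; move: (vF e).
rewrite !(face_compE, face_oppE).
by case: (v e) => [[]|]; case: (F e) => [[]|] //= [].
Qed.

Lemma rank_flip v F : v <=f F -> face_rank (v ** -f F) = face_rank F.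
Proof.
by move=> vF; apply/eqP; rewrite eqn_leq !face_rank_supp ?supp_flip.
Qed.

(** The two edges at [v] of a tope [D] and their reflections through [v] are four distinct edges. *)
Lemma vertex_degree v : face_rank v = 1 ->
  (4 <= #|[set F | (face_rank F == 2) && (v <=f F)]|).
Proof.
move=> rkv; have [T rkT] := om_rank_witness; pose D := v ** T.
have rkD : face_rank D = 3.
  apply/eqP; rewrite eqn_leq -ltnS face_rank_le3 -rank3 -rkT.
  by rewrite face_rank_supp // supp_comp subsetUr.
have vD : v <=f D by apply: face_le_compr.
have /eqP/cards2P[F [G [neqFG eqA]]] := card_corner_edges rkv rkD vD.
have edgeP X : X \in [set F; G] ->
    [/\ v <=f X, v != X, X <=f D & face_rank X = 2].
  rewrite -eqA inE => /andP[/andP[vX XD] /eqP rkX]; split=> //.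
  by apply: contra_eq_neq rkv => ->; rewrite rkX.
have [vF neqvF FD rkF] := edgeP F (set21 _ _).
have [vG neqvG GD rkG] := edgeP G (set22 _ _).
pose s := [:: F; G; v ** -f F; v ** -f G].
have uniq_s : uniq s.
  have neqFGf : v ** -f F != v ** -f G.
    by apply: contra neqFG => /eqP FG; rewrite -[F](flipK vF) FG flipK.
  rewrite /= !inE !negb_or neqFG neqFGf ![_ == v ** _]eq_sym.
  by rewrite (flip_neq vF neqvF FD FD) (flip_neq vG neqvG GD FD)
    (flip_neq vF neqvF FD GD) (flip_neq vG neqvG GD GD).
rewrite -[4]/(size s) -(card_uniqP uniq_s); apply/subset_leq_card/subsetP => X.
rewrite !inE => /or4P[] /eqP ->; rewrite ?rank_flip ?face_le_compr //.
- by rewrite rkF vF.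
- by rewrite rkG vG.
- by rewrite rkF.
- by rewrite rkG.
Qed.

(** By rank, [F ** C] covers [F], and all topes have the same support, so [face_covers_flip] leaves
    only the reflection of [F ** C] in [F]. *)
Lemma topes_at_edge F C : face_rank F = 2 -> face_rank C = 3 ->
  F ** C != F ** -f C /\
  [set D | (face_rank D == 3) && (F <=f D)] = [set F ** C; F ** -f C].
Proof.
move=> rkF rkC.
have full X : face_rank X = 3 -> supp X = supp C.
  move=> rkX; apply/eqP; rewrite eqEsubset.
  by rewrite !face_rank_om_supp ?rank3.
have rk3 X : supp X = supp C -> face_rank X = 3.
  by move=> sX; apply/eqP; rewrite -rkC eqn_leq !face_rank_supp ?sX.
have sFC X : supp X = supp C -> supp (F ** X) = supp C.
  move=> sX; rewrite supp_comp sX; apply/setUidPr.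
  by rewrite face_rank_om_supp ?rank3.
have covF : face_covers (F ** C) F.
  by apply: rank_succ_covers; rewrite ?face_le_compr // rk3 ?sFC // rkF.
have flipE : F ** -f (F ** C) = F ** -f C.
  apply: face_eqP => e; rewrite !(face_compE, face_oppE).
  by case: (F e) => [[]|].
split.
  have [_ neqF _] := covF.
  rewrite eq_sym -flipE; apply: (@flip_neq _ _ _ (F ** C)) => //;
  by rewrite ?face_le_compr ?face_le_refl.
apply/setP => D; rewrite !inE; apply/andP/orP => [[/eqP rkD FD]|].
  have sD : supp D = supp (F ** C) by rewrite sFC ?full.
  have [->|] := face_covers_flip covF FD sD; first by left.
  by rewrite flipE => ->; right.
by case=> /eqP ->; rewrite face_le_compr rk3 // sFC // supp_opp.
Qed.

Lemma double_count i j :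
  (\sum_(D : face M | face_rank D == j) #|faces_of_rank i D| =
   \sum_(F : face M | face_rank F == i)
      #|[set D | (face_rank D == j) && (F <=f D)]|).
Proof.
under eq_bigr do rewrite -sum1_card; under [RHS]eq_bigr do rewrite -sum1_card.
rewrite (exchange_big_dep (fun F : face M => face_rank F == i)) /= => [|D F _].
  by apply: eq_bigr => F /eqP rkF; apply: eq_bigl => D; rewrite !inE rkF eqxx.
by rewrite inE => /andP[].
Qed.

Lemma sum_tope_edges :
  (\sum_(D : face M | face_rank D == 3) #|faces_of_rank 2 D| = f_ 2 * 2).
Proof.
have [C rkC] := om_rank_witness; rewrite rank3 in rkC.
rewrite double_count -sum_nat_const; apply: eq_big => F; first by rewrite inE.
move=> /eqP rkF; have [neq ->] := topes_at_edge rkF rkC.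
by rewrite cards2 neq.
Qed.

Lemma sum_vertex_degrees : (4 * f_ 1 <= f_ 2 * 2).
Proof.
have -> : f_ 2 * 2 =
    \sum_(F : face M | face_rank F == 2) #|faces_of_rank 1 F|.
  rewrite -sum_nat_const; apply: eq_big => F; first by rewrite inE.
  by rewrite inE => /eqP /card_edge_vertices ->.
rewrite double_count mulnC -sum_nat_const.
rewrite (eq_bigl (fun v => face_rank v == 1)) => [|v]; last by rewrite inE.
by apply: leq_sum => v /eqP /vertex_degree.
Qed.

(** * The two products of [sigma M 2] and [sigma M 3] *)

Local Open Scope ring_scope.

(** Doubling pairs each tope [C] with [-f C]: [F ** C] and [F ** -f C] are the two topes at [F],
    whatever [C] is. *)
Lemma sigma23_double : sigma M 2 * sigma M 3 *+ 2 =
  \sum_(D | face_rank D == 3) << (#|faces_of_rank 2 D| * f_ 3)%:R *g D >>.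
Proof.
pose topes F : malgM := \sum_(D | (face_rank D == 3) && (F <=f D)) << D >>.
transitivity (\sum_(F : face M | face_rank F == 2) topes F *+ f_ 3).
  rewrite [X in X *+ 2]mulr_suml -sumrMnl; apply: eq_bigr => F /eqP rkF.
  rewrite mulr_sumr mulr2n.
  rewrite [X in _ + X](reindex_inj (inv_inj face_oppK)) /=.
  rewrite [X in _ + X](eq_bigl (fun C => face_rank C == 3)) => [|C]; last first.
    by rewrite face_rank_opp.
  rewrite -big_split /= (eq_bigr (fun=> topes F)) => [|C /eqP rkC].
    by rewrite sumr_const; congr (_ *+ _); apply: eq_card => C; rewrite inE.
  have [neq eqD] := topes_at_edge rkF rkC.
  rewrite /topes (eq_bigl (fun D => D \in [set F ** C; F ** -f C])) => [|D];
    last first.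
    by rewrite -eqD inE.
  by rewrite big_setU1 ?inE //= big_set1 !malgUM mul1r.
rewrite sumrMnl /topes.
rewrite (exchange_big_dep (fun D => face_rank D == 3)) /= => [|F D _ /andP[]//].
rewrite -sumrMnl; apply: eq_bigr => D /eqP rkD.
rewrite sumr_const -mulrnA [RHS]monalgUMn; congr (_ *+ (_ * _)).
by apply: eq_card => F; rewrite !inE rkD.
Qed.

(** A tope absorbs every edge on its right; the factor 2 matches [sigma23_double]. *)
Lemma sigma32_double : sigma M 3 * sigma M 2 *+ 2 =
  \sum_(D | face_rank D == 3) << (2 * f_ 2)%:R *g D >>.
Proof.
rewrite [X in X *+ 2]mulr_suml -sumrMnl; apply: eq_bigr => D /eqP rkD.
rewrite mulr_sumr (eq_bigr (fun=> << D >>)) => [|F _]; last first.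
  by rewrite malgUM mul1r comp_supp // face_rank_om_supp ?rank3.
rewrite sumr_const -mulrnA mulnC [RHS]monalgUMn; congr (_ *+ (_ * _)).
by apply: eq_card => F; rewrite inE.
Qed.

Lemma malg_mulr2I (x y : malgM) : x *+ 2 = y *+ 2 -> x = y.
Proof.
move=> eq2; apply/malgP => K; apply: (@pmulrnI _ 2) => //.
by rewrite -2!mcoeffMn eq2.
Qed.

Lemma sigma23_commP :
  sigma M 2 * sigma M 3 = sigma M 3 * sigma M 2 <->
  forall D, face_rank D = 3%N -> (#|faces_of_rank 2 D| * f_ 3 = 2 * f_ 2)%N.
Proof.
split=> [eq_s D rkD|eq_n].
  have eq2 := etrans (esym sigma23_double)
    (etrans (congr1 (fun x : malgM => x *+ 2) eq_s) sigma32_double).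
  have := etrans (esym (mcoeff_sumU _ _ D))
    (etrans (congr1 (mcoeff D) eq2) (mcoeff_sumU _ _ D)).
  by rewrite rkD eqxx => /eqP; rewrite eqr_nat => /eqP.
apply: malg_mulr2I.
apply: etrans sigma23_double (etrans _ (esym sigma32_double)).
by apply: eq_bigr => D /eqP rkD; rewrite eq_n.
Qed.

(** * Commutation and triangular topes *)

Lemma card_vertices_gt2 : (2 < f_ 1)%N.
Proof.
have [T rkT] := om_rank_witness; rewrite rank3 in rkT.
have [F [FT neqFT]] := face_rank_pred (face_rank_neq0 rkT).
rewrite rkT => -[/esym rkF].
have /eqP/cards2P[v [w [neqvw eqA]]] := card_edge_vertices rkF.
have vertexP x : x \in [set v; w] -> face_rank x = 1%N /\ x <=f F.
  by rewrite -eqA inE => /andP[/eqP].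
have [rkv vF] := vertexP v (set21 _ _).
have [rkw wF] := vertexP w (set22 _ _).
(* The third vertex is [-f v], the reflection of [v] in the zero face; it is no face of [F], hence
   neither [v] nor [w]. *)
have neqNv x : x <=f F -> -f v != x.
  rewrite -[-f v]face_comp0l; apply: flip_neq vF.
  - exact: face_le0.
  - by rewrite eq_sym (face_rank_neq0 rkv).
have uniq_s : uniq [:: v; w; -f v].
  by rewrite /= !inE negb_or neqvw ![_ == -f v]eq_sym !neqNv.
rewrite -[3%N]/(size [:: v; w; -f v]) -(card_uniqP uniq_s).
apply/subset_leq_card/subsetP => X; rewrite !inE.
by case/or3P=> /eqP ->; rewrite ?face_rank_opp ?rkv ?rkw.
Qed.

Lemma simplicial3P :
  simplicial3 M <-> forall D, face_rank D = 3%N -> #|faces_of_rank 2 D| = 3%N.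
Proof.
split=> triM D rkD; first by have /andP[_ /eqP] := triM D rkD.
by rewrite /triangle card_tope_vertices // triM ?eqxx.
Qed.

Lemma sigma23_comm_simplicial :
  sigma M 2 * sigma M 3 = sigma M 3 * sigma M 2 <-> simplicial3 M.
Proof.
have eulerM := euler_count; have degM := sum_vertex_degrees.
have gt2 := card_vertices_gt2; have sidesM := sum_tope_edges.
split=> [/sigma23_commP nE | /simplicial3P triM].
  (* Let [D] have [n] sides, so [n f_3 = 2 f_2]. If [n >= 4] then [2 f_3 <= f_2], whereas Euler's
     formula and [2 f_1 <= f_2] give [2 f_3 >= f_2 + 4]. If [n <= 2] then [f_2 <= f_3], whence
     [f_1 <= 2]. *)
  by apply/simplicial3P => D rkD; have := nE D rkD; nia.
apply/sigma23_commP => D rkD; rewrite triM //.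
suff : (f_ 3 * 3 = f_ 2 * 2)%N by lia.
rewrite -sidesM -sum_nat_const; apply: eq_big => C; first by rewrite inE.
by rewrite inE => /eqP /triM.
Qed.

End RankThree.

End Faces.

Theorem theorem8p6 (E : finType) (S : orientedMatroid E)
    (rank3 : om_rank S = 3) :
  [<-> (sigma S 1 * sigma S 2 = sigma S 2 * sigma S 1)%R;
       (sigma S 1 * sigma S 3 = sigma S 3 * sigma S 1)%R;
       (sigma S 2 * sigma S 3 = sigma S 3 * sigma S 2)%R;
       simplicial3 S].
Proof.
have [c12 c13] := sigma_comm12_13 rank3.
have [d13 d23] := sigma_comm13_23 rank3.
have [e23 e3] := sigma23_comm_simplicial rank3.
split; first exact: c12.
split; first exact: d13.
split; first exact: e23.
exact: (fun triS => c13 (d23 (e3 triS))).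
Qed.
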